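(* Let $\mathbb{F}$ be a field, let $k\ge 2$ and $n\ge k+1$ be integers, and let $S_n$ be the star graph on vertex set $\{1,\ldots,n\}$ with edges $\{i,n\}$ for $i=1,\ldots,n-1$. Then both $\mathbb{F}[\Delta_k^t(S_n)]$ and $\mathbb{F}[\Delta_k^t(S_n)^\vee]$ are Cohen-Macaulay, and both have linear resolutions.
   Context: A simplicial complex on a finite set $V$ is a collection of subsets of $V$ closed under taking subsets (an element of $V$ need not itself be a face). Its Stanley-Reisner ring over $\mathbb{F}$ is $\mathbb{F}[\Delta]=S/I_\Delta$, where $S=\mathbb{F}[x_v : v\in V]$ and $I_\Delta$ is generated by the monomials $\prod_{v\in F}x_v$ for all $F\subseteq V$ with $F\notin\Delta$. For a finite simple graph $G=(V,E)$ and a positive integer $k$, $\Delta_k^t(G)$ is the simplicial complex on $V$ whose facets are the complements $V\setminus M$ of the independent sets $M\subseteq V$ of size $k$ (independent: no two elements adjacent). The Alexander dual of $\Delta$ is $\Delta^\vee=\{F\subseteq V : V\setminus F\notin\Delta\}$, a complex on the same set $V$. For a homogeneous ideal $I\subseteq S$, $\beta_{i,j}=\dim_{\mathbb{F}}\mathrm{Tor}^S_i(S/I,\mathbb{F})_j$ are the graded Betti numbers of $S/I$. $S/I$ has an $s$-linear resolution if $I$ is generated in degree $s$ and $\beta_{i,j}=0$ whenever $i\ge1$ and $j\ne s+i-1$; it has a linear resolution if it has an $s$-linear resolution for some $s\ge 1$. *)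

(* Defs.v *)
From HB Require Import structures.
From mathcomp Require Import all_boot all_order all_algebra.
From mathcomp Require Import mpoly.

Set Implicit Arguments.
Unset Strict Implicit.
Unset Printing Implicit Defensive.

Import GRing.Theory.
Local Open Scope ring_scope.

Section Complexes.
Variable n : nat.
Implicit Types (D : {set {set 'I_n}}) (e : rel 'I_n).

Definition independent e (M : {set 'I_n}) : bool :=
  [forall x in M, forall y in M, ~~ e x y].

(* The faces are the subsets of the facets [~: M]. *)
Definition total_cut_complex (k : nat) e : {set {set 'I_n}} :=
  [set A : {set 'I_n} |
     [exists M : {set 'I_n}, [&& independent e M, #|M| == k & A \subset ~: M]]].

Definition alexander_dual D : {set {set 'I_n}} :=
  [set A : {set 'I_n} | ~: A \notin D].

(* The vertices 1, ..., n are the ordinals 0, ..., n.-1, so the centre of the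
   star is n.-1. *)
Definition star : rel 'I_n :=
  fun x y => (x != y) && ((x == n.-1 :> nat) || (y == n.-1 :> nat)).

End Complexes.

Arguments star : clear implicits.

Section Ideals.
Variables (F : fieldType) (n : nat).
Local Notation S := {mpoly F[n]}.
Implicit Types (I P : S -> Prop) (f g : S).

Definition is_ideal I : Prop :=
  [/\ I 0, forall f g, I f -> I g -> I (f + g) & forall f g, I g -> I (f * g)].

Definition ideal_gen (G : S -> Prop) : S -> Prop :=
  fun f => exists (r : nat) (c g : 'I_r -> S),
    (forall i, G (g i)) /\ f = \sum_(i < r) c i * g i.

Definition stanley_reisner_ideal (D : {set {set 'I_n}}) : S -> Prop :=
  ideal_gen (fun g => exists2 A : {set 'I_n}, A \notin D & g = \prod_(v in A) 'X_v).

Definition is_prime_ideal P : Prop :=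
  [/\ is_ideal P, ~ P 1 & forall f g, P (f * g) -> P f \/ P g].

(* Throughout, the quotient ring S/I is represented by the ideal I: the ideals
   of S/I are the ideals of S containing I. *)

Definition prime_chain I (d : nat) : Prop :=
  exists P : nat -> S -> Prop,
    (forall i, (i <= d)%N ->
       is_prime_ideal (P i) /\ (forall f, I f -> P i f)) /\
    (forall i, (i < d)%N ->
       (forall f, P i f -> P i.+1 f) /\ (exists2 f, P i.+1 f & ~ P i f)).

Definition krull_dim I (d : nat) : Prop :=
  prime_chain I d /\ forall d', prime_chain I d' -> (d' <= d)%N.

Definition irrelevant_ideal : S -> Prop := fun f => f@_0%MM = 0.

Definition ideal_adjoin I (fs : seq S) : S -> Prop :=
  ideal_gen (fun g => I g \/ g \in fs).

(* fs is an S/I-regular sequence contained in the irrelevant ideal. *)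
Definition regular_sequence I (fs : seq S) : Prop :=
  [/\ forall f, f \in fs -> irrelevant_ideal f,
      forall i, (i < size fs)%N -> forall g,
        ideal_adjoin I (take i fs) (nth 0 fs i * g) ->
        ideal_adjoin I (take i fs) g
    & ~ ideal_adjoin I fs 1].

Definition depth I (d : nat) : Prop :=
  (exists2 fs, regular_sequence I fs & size fs = d) /\
  forall fs, regular_sequence I fs -> (size fs <= d)%N.

(* Cohen-Macaulayness of the standard graded algebra S/I. *)
Definition cohen_macaulay I : Prop := exists2 d, krull_dim I d & depth I d.

(* A graded resolution ... -> F_1 -> F_0 -> S/I -> 0 by free S-modules of
   finite rank.  F_i = S^(gr_rank i) consists of row vectors, its a-th basis
   vector has degree gr_deg i a, the maps act by right multiplication, and
   gr_aug is a lift to S of the augmentation F_0 -> S/I. *)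
Record graded_free_resolution I := GradedFreeResolution {
  gr_rank : nat -> nat;
  gr_deg : forall i : nat, 'I_(gr_rank i) -> nat;
  gr_aug : 'cV[S]_(gr_rank 0);
  gr_diff : forall i, 'M[S]_(gr_rank i.+1, gr_rank i);
  gr_aug_homog : forall a, gr_aug a 0 \is (gr_deg a).-homog;
  gr_diff_homog : forall i a b, gr_diff i a b != 0 ->
    (gr_deg b <= gr_deg a)%N /\
    gr_diff i a b \is (gr_deg a - gr_deg b).-homog;
  gr_aug_surj : forall f, exists v : 'rV[S]_(gr_rank 0), I (f - (v *m gr_aug) 0 0);
  gr_exact0 : forall v : 'rV[S]_(gr_rank 0),
    I ((v *m gr_aug) 0 0) <-> exists w : 'rV[S]_(gr_rank 1), v = w *m gr_diff 0%N;
  gr_exact : forall i (v : 'rV[S]_(gr_rank i.+1)),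
    v *m gr_diff i = 0 <-> exists w : 'rV[S]_(gr_rank i.+2), v = w *m gr_diff i.+1
}.

Section Tor.
Variables (I : S -> Prop) (R : graded_free_resolution I).

Definition gr_gens (i j : nat) : {set 'I_(gr_rank R i)} :=
  [set a | gr_deg a == j].

(* The degree j part of the differential F_(i+1) (x) F -> F_i (x) F, where F is
   the quotient of S by the irrelevant ideal, in the bases gr_gens. *)
Definition tor_diff (i j : nat) : 'M[F]_(#|gr_gens i.+1 j|, #|gr_gens i j|) :=
  \matrix_(a, b) (gr_diff R i (enum_val a) (enum_val b))@_0%MM.

Definition tor_cycles (i j : nat) : 'M[F]_(#|gr_gens i j|) :=
  match i with
  | 0 => 1%:M
  | i'.+1 => kermx (tor_diff i' j)
  end.

(* dim (cycles / boundaries); the boundaries are contained in the cycles, so the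
   subtraction does not truncate. *)
Definition dim_tor (i j : nat) : nat :=
  (\rank (tor_cycles i j) - \rank (tor_diff i j))%N.

End Tor.

(* beta_(i,j)(S/I) = b.  Tor does not depend on the resolution computing it. *)
Definition graded_betti I (i j b : nat) : Prop :=
  exists R : graded_free_resolution I, dim_tor R i j = b.

Definition generated_in_degree I (s : nat) : Prop :=
  forall f, I f <-> ideal_gen (fun g => I g /\ g \is s.-homog) f.

Definition s_linear_resolution I (s : nat) : Prop :=
  generated_in_degree I s /\
  forall i j, (1 <= i)%N -> j <> (s + i - 1)%N -> graded_betti I i j 0%N.

Definition linear_resolution I : Prop :=
  exists2 s, (1 <= s)%N & s_linear_resolution I s.

End Ideals.

Arguments stanley_reisner_ideal F {n} D _.

(* Main.v *)
Require Import Defs.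
From mathcomp Require Import all_boot all_order all_algebra.
From mathcomp Require Import mpoly.
From mathcomp Require Import zify ring.
From Stdlib Require Import FunctionalExtensionality PropExtensionality.
From Stdlib Require Import ClassicalEpsilon.

(* Both ideals are generated by the squarefree monomials of some degree [t] in the
   variables other than the one of the centre: [t = n - k] for the complex and [t = k] for
   its dual.  Write [V t A B] for the ideal generated by the squarefree monomials of degree
   [t] in the variables [A] together with the variables [B].

   Regular sequences: for [v] in [A], the sequence [0 -> S/(J : x_v) -> S/J -> S/(J + x_v)
   -> 0] with [J = V t A B] has ends of the same shape, and iterating it reduces
   the regularity of the elementary symmetric polynomials [e_s, ..., e_1] to rings
   [S/(x_v : v in B)], where [e_s] is congruent to the product of the [s] remaining variables;
   killing it gives again an ideal [V s A' B], with the sequence [e_(s-1), ..., e_1] left.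

   Upper bounds on depth and dimension: regular sequences and chains of primes both give
   elements which are algebraically independent modulo the ideal, whereas counting
   monomials shows that [t + 1] elements are always dependent.

   Linear resolutions: [V t+1 A] is the sum of [V t+1 (A - v)] and [x_v V t (A - v)], which
   intersect in [x_v V t+1 (A - v)], and a mapping cone produces its resolution. *)

Set Implicit Arguments.
Unset Strict Implicit.
Unset Printing Implicit Defensive.

Import GRing.Theory.
Local Open Scope ring_scope.

(** * Ideals *)

Section IdealTheory.
Variables (F : fieldType) (n : nat).
Local Notation S := {mpoly F[n]}.
Implicit Types (I J G : S -> Prop) (f g h : S) (fs : seq S).

(** Ideals are predicates. The extensionality axioms turn equivalent ideals into equal ones, which
    can then be rewritten under any notion applied to them. *)
Lemma ideal_ext I J : (forall f, I f <-> J f) -> I = J.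
Proof.
by move=> eqIJ; apply: functional_extensionality => f; apply: propositional_extensionality.
Qed.

Section OneIdeal.
Variables (I : S -> Prop) (idI : is_ideal I).

Lemma ideal0 : I 0. Proof. by case: idI. Qed.

Lemma idealD f g : I f -> I g -> I (f + g). Proof. by case: idI => _ + _; apply. Qed.

Lemma idealMl f g : I g -> I (f * g). Proof. by case: idI => _ _; apply. Qed.

Lemma idealN f : I f -> I (- f). Proof. by rewrite -mulN1r; apply: idealMl. Qed.

Lemma idealB f g : I f -> I g -> I (f - g).
Proof. by move=> If Ig; apply/idealD/idealN. Qed.

Lemma idealBr f g : I g -> I (f - g) -> I f.
Proof. by move=> Ig /idealD/(_ Ig); rewrite subrK. Qed.

Lemma idealZ c f : I f -> I (c *: f).
Proof. by rewrite -mul_mpolyC; apply: idealMl. Qed.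

Lemma ideal_sum (T : Type) (r : seq T) (P : pred T) (E : T -> S) :
  (forall i, P i -> I (E i)) -> I (\sum_(i <- r | P i) E i).
Proof. by move=> IE; elim/big_rec: _ => [|i x Pi Ix]; [apply: ideal0 | apply: idealD; auto]. Qed.

Lemma ideal_of_msupp f : {in msupp f, forall m, I 'X_[m]} -> I f.
Proof.
move=> If; rewrite (mpolyE f) big_seq; apply: ideal_sum => m mf.
exact/idealZ/If.
Qed.

End OneIdeal.

Lemma ideal_gen_ideal G : is_ideal (ideal_gen G).
Proof.
split.
- exists 0%N, (fun=> 0), (fun=> 0); split; first by case.
  by rewrite big_ord0.
- move=> f g [r1 [c1 [g1 [Gg1 ->]]]] [r2 [c2 [g2 [Gg2 ->]]]].
  exists (r1 + r2)%N, (fun i => match split i with inl j => c1 j | inr j => c2 j end),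
    (fun i => match split i with inl j => g1 j | inr j => g2 j end); split.
    by move=> i; case: splitP.
  rewrite big_split_ord /=; congr (_ + _); apply: eq_bigr => i _.
    by rewrite -/(unsplit (inl i)) unsplitK.
  by rewrite -/(unsplit (inr i)) unsplitK.
- move=> f g [r [c [g1 [Gg ->]]]]; exists r, (fun i => f * c i), g1; split=> //.
  by rewrite mulr_sumr; apply: eq_bigr => i _; rewrite mulrA.
Qed.

Lemma sub_ideal_gen G g : G g -> ideal_gen G g.
Proof.
by move=> Gg; exists 1%N, (fun=> 1), (fun=> g); rewrite big_ord1 mul1r.
Qed.

Lemma ideal_gen_min G J f :
  is_ideal J -> (forall g, G g -> J g) -> ideal_gen G f -> J f.
Proof.
move=> idJ GJ [r [c [g [Gg ->]]]].
by apply: ideal_sum => // i _; apply: idealMl => //; exact/GJ.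
Qed.

Lemma ideal_adjoin_ideal I fs : is_ideal (ideal_adjoin I fs).
Proof. exact: ideal_gen_ideal. Qed.

Lemma sub_ideal_adjoin I fs f : I f -> ideal_adjoin I fs f.
Proof. by move=> If; apply: sub_ideal_gen; left. Qed.

Lemma mem_ideal_adjoin I fs f : f \in fs -> ideal_adjoin I fs f.
Proof. by move=> If; apply: sub_ideal_gen; right. Qed.

Lemma ideal_adjoin_min I J fs f : is_ideal J -> (forall g, I g -> J g) ->
  (forall g, g \in fs -> J g) -> ideal_adjoin I fs f -> J f.
Proof. by move=> idJ IJ fsJ; apply: ideal_gen_min => // g [/IJ|/fsJ]. Qed.

Lemma ideal_adjoin_cat I fs1 fs2 :
  ideal_adjoin I (fs1 ++ fs2) = ideal_adjoin (ideal_adjoin I fs1) fs2.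
Proof.
apply: ideal_ext => f; split; apply: ideal_adjoin_min.
- exact: ideal_adjoin_ideal.
- by move=> g Ig; do 2!apply: sub_ideal_adjoin.
- move=> g; rewrite mem_cat => /orP[gfs|]; last exact: mem_ideal_adjoin.
  exact/sub_ideal_adjoin/mem_ideal_adjoin.
- exact: ideal_adjoin_ideal.
- move=> g; apply: ideal_adjoin_min; first exact: ideal_adjoin_ideal.
    exact: sub_ideal_adjoin.
  by move=> h hfs; apply: mem_ideal_adjoin; rewrite mem_cat hfs.
- by move=> g gfs; apply: mem_ideal_adjoin; rewrite mem_cat gfs orbT.
Qed.

Lemma ideal_adjoin_nil I : is_ideal I -> ideal_adjoin I [::] = I.
Proof.
move=> idI; apply: ideal_ext => f; split; last exact: sub_ideal_adjoin.
by apply: ideal_adjoin_min.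
Qed.

Lemma ideal_adjoin1P I f g : is_ideal I ->
  ideal_adjoin I [:: f] g <-> exists a, I (g - a * f).
Proof.
move=> idI; split=> [|[a Ia]]; last first.
  have idJ := ideal_adjoin_ideal I [:: f].
  apply: (idealBr idJ _ (sub_ideal_adjoin _ Ia)).
  by apply/(idealMl idJ)/mem_ideal_adjoin; rewrite inE.
apply: (@ideal_adjoin_min _ (fun g => exists a, I (g - a * f))).
- split; first by exists 0; rewrite mul0r subr0; apply: ideal0.
  + move=> x y [a Ia] [b Ib]; exists (a + b).
    by rewrite mulrDl opprD addrACA; apply: idealD.
  + move=> x y [a Ia]; exists (x * a).
    by rewrite -mulrA -mulrBr; apply: idealMl.
- by move=> h Ih; exists 0; rewrite mul0r subr0.
- by move=> h; rewrite inE => /eqP->; exists 1; rewrite mul1r subrr; apply: ideal0.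
Qed.

End IdealTheory.

(** * Ideals spanned by monomials *)

Section MonomialIdeals.
Variables (F : fieldType) (n : nat).
Local Notation S := {mpoly F[n]}.
Implicit Types (f g h : S) (A B : {set 'I_n}) (m : 'X_{1..n}) (p : pred 'X_{1..n}).

Definition mnm_supp m : {set 'I_n} := [set i | m i != 0%N].

Lemma mnm_supp0 : mnm_supp 0%MM = set0.
Proof. by apply/setP => i; rewrite !inE mnm0E. Qed.

Lemma mnm_suppD m1 m2 : mnm_supp (m1 + m2)%MM = mnm_supp m1 :|: mnm_supp m2.
Proof. by apply/setP => i; rewrite !inE mnmDE addn_eq0 negb_and. Qed.

Lemma mnm_suppU i : mnm_supp U_(i)%MM = [set i].
Proof. by apply/setP => j; rewrite !inE mnm1E (eq_sym j); case: (i == j). Qed.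

Lemma mnm_supp_mesym1 A : mnm_supp (mesym1 A) = A.
Proof. by apply/setP => i; rewrite inE mnmE; case: (i \in A). Qed.

Lemma mesym1_le A m : (mesym1 A <= m)%MM = (A \subset mnm_supp m).
Proof.
apply/mnm_lepP/subsetP => [le i iA|sub i].
  by rewrite inE -lt0n; apply: leq_trans (le i); rewrite mnmE iA.
by rewrite mnmE; case: (boolP (i \in A)) => //= /sub; rewrite inE lt0n.
Qed.

Lemma prod_mpolyX A : \prod_(v in A) 'X_v = 'X_[mesym1 A] :> S.
Proof.
rewrite mprodXE; congr 'X_[_]; apply/mnmP => i; rewrite mnmE mnm_sumE.
have [iA|iA] := boolP (i \in A).
  rewrite (bigD1 i) //= mnm1E eqxx big1 // => j /andP[_ neq].
  by rewrite mnm1E (negbTE neq).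
rewrite big1 // => j jA; rewrite mnm1E; case: eqP => // eqji.
by rewrite -eqji jA in iA.
Qed.

(** Membership is a condition on the monomials of [f], with no choice of generators; it defines an
    ideal as soon as [p] is [upclosed]. *)
Definition monomial_ideal p f : Prop := {in msupp f, forall m, p m}.

Lemma monomial_idealX p m : monomial_ideal p 'X_[m] <-> p m.
Proof.
split=> [|pm m' /mem_msuppXP <- //]; apply.
by apply/mem_msuppXP.
Qed.

Definition upclosed p := forall m1 m2, p m2 -> p (m1 + m2)%MM.

Lemma monomial_ideal_ideal p : upclosed p -> is_ideal (monomial_ideal p).
Proof.
move=> up; split=> [m|f g If Ig m|f g Ig m].
- by rewrite msupp0.
- by move/msuppD_le; rewrite mem_cat => /orP[/If|/Ig].
- by case/msuppM_le/allpairsP => -[m1 m2] /= [_ /Ig pm2 ->]; apply: up.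
Qed.

Lemma mpoly_split p f : exists2 fs : S * S, f = fs.1 + fs.2 &
  {in msupp fs.1, forall m, p m /\ m \in msupp f} /\
  {in msupp fs.2, forall m, ~~ p m /\ m \in msupp f}.
Proof.
exists (\sum_(m <- msupp f | p m) f@_m *: 'X_[m],
        \sum_(m <- msupp f | ~~ p m) f@_m *: 'X_[m]) => /=.
  by rewrite [LHS]mpolyE (bigID p).
have mem (q : pred 'X_{1..n}) m :
    m \in msupp (\sum_(m <- msupp f | q m) f@_m *: 'X_[m]) -> q m /\ m \in msupp f.
  move=> mq; apply/andP; apply: contraLR mq => nm.
  rewrite mcoeff_msupp negbK raddf_sum /= big_seq_cond big1 // => m' /andP[m'f qm'].
  rewrite mcoeffZ mcoeffX; case: eqP => [eqm|]; rewrite ?mulr0 //.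
  by rewrite -eqm qm' m'f in nm.
by split=> m; apply: mem.
Qed.

Lemma msuppXM m f : {subset [seq (m + m')%MM | m' <- msupp f] <= msupp ('X_[m] * f)}.
Proof.
by move=> _ /mapP[m' m'f ->]; rewrite mcoeff_msupp mulrC mcoeffMX -mcoeff_msupp.
Qed.

Lemma monomial_idealXM p m f :
  monomial_ideal p ('X_[m] * f) <-> monomial_ideal (fun m' => p (m + m')%MM) f.
Proof.
split=> [If m' m'f|If m' /msuppM_le/allpairsP[[m1 m2] [/mem_msuppXP <- m2f ->]]].
  exact/If/msuppXM/map_f.
exact: If.
Qed.

Lemma mpoly_divX i f : {in msupp f, forall m, m i != 0%N} -> exists h, f = 'X_i * h.
Proof.
move=> fi; exists (\sum_(m <- msupp f) f@_m *: 'X_[m - U_(i)]).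
rewrite [LHS]mpolyE mulr_sumr !big_seq; apply: eq_bigr => m /fi mi.
by rewrite -scalerAr -mpolyXD addmC submK // lep1mP.
Qed.

End MonomialIdeals.

(** * Regular sequences *)

Lemma disjoint_setU (T : finType) (A B C : {set T}) :
  [disjoint A :|: B & C] = [disjoint A & C] && [disjoint B & C].
Proof. by rewrite -!setI_eq0 setIUl setU_eq0. Qed.

(** * Squarefree Veronese ideals *)

Section Veronese.
Variables (F : fieldType) (n : nat).
Local Notation S := {mpoly F[n]}.
Implicit Types (f g h : S) (A B C : {set 'I_n}) (m : 'X_{1..n}) (t : nat).

(** At [t = 0] every monomial qualifies, and for [t] above [#|A|] only those meeting [B] do; the
    inductions below stop at these degenerate cases. *)
Definition veronese_pred t A B m :=
  (t <= #|mnm_supp m :&: A|)%N || ~~ [disjoint mnm_supp m & B].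

Definition veronese t A B : S -> Prop := monomial_ideal (veronese_pred t A B).

Lemma veronese_pred_upclosed t A B : upclosed (veronese_pred t A B).
Proof.
move=> m1 m2; rewrite /veronese_pred mnm_suppD disjoint_setU negb_and.
case/orP => [le_t|->]; last by rewrite !orbT.
by rewrite (leq_trans le_t) // subset_leq_card // setSI // subsetUr.
Qed.

Lemma veronese_ideal t A B : is_ideal (veronese t A B).
Proof. exact/monomial_ideal_ideal/veronese_pred_upclosed. Qed.

(** Every monomial is a multiple of the squarefree monomial of its support, so it lies in the
    Stanley-Reisner ideal once its support is a nonface. *)
Lemma stanley_reisner_veronese (D : {set {set 'I_n}}) t A :
  (forall C, (C \notin D) = (t <= #|C :&: A|)%N) ->
  stanley_reisner_ideal F D = veronese t A set0.
Proof.
move=> nD; apply: ideal_ext => f; split=> [|Vf].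
  apply: ideal_gen_min; first exact: veronese_ideal.
  move=> g [C CD ->]; rewrite prod_mpolyX; apply/monomial_idealX.
  by rewrite /veronese_pred mnm_supp_mesym1 -nD CD.
apply: (ideal_of_msupp (ideal_gen_ideal _)) => m /Vf.
rewrite /veronese_pred -setI_eq0 setI0 eqxx orbF -nD => mD.
have := submK (m := mesym1 (mnm_supp m)) (m' := m); rewrite mesym1_le => <- //.
rewrite mpolyXD; apply/(idealMl (ideal_gen_ideal _))/sub_ideal_gen.
by exists (mnm_supp m); rewrite ?prod_mpolyX.
Qed.

(** Multiplication by ['X_v] puts [v] in the support, whether or not it was there; [v] accounts for
    one of the [t.+1] variables, and the other [t] must come from [A :\ v]. *)
Lemma veronese_colon t A B v : v \in A -> [disjoint A & B] ->
  (fun g => veronese t.+1 A B ('X_v * g)) = veronese t (A :\ v) B.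
Proof.
move=> vA dAB; apply: ideal_ext => g.
suff eqp m : veronese_pred t.+1 A B (U_(v) + m)%MM = veronese_pred t (A :\ v) B m.
  by rewrite /veronese monomial_idealXM; split=> Vg m /Vg; rewrite eqp.
rewrite /veronese_pred mnm_suppD mnm_suppU disjoint_setU disjoints1.
rewrite (disjointFr dAB vA) /=; congr (_ || _).
rewrite [in LHS](cardsD1 v) !inE eqxx vA /= add1n ltnS; congr (_ <= #|pred_of_set _|)%N.
by apply/setP => i; rewrite !inE; case: (i == v); rewrite ?andbF.
Qed.

(** Modulo ['X_v] only the monomials avoiding [v] survive, and for these [A] and [A :\ v] give the
    same count. *)
Lemma veronese_adjoin t A B v :
  ideal_adjoin (veronese t A B) [:: 'X_v] = veronese t (A :\ v) (v |: B).
Proof.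
apply: ideal_ext => f; split.
  apply: ideal_adjoin_min; first exact: veronese_ideal.
    move=> g Vg m /Vg; rewrite /veronese_pred [_ |: _]setUC.
    rewrite [[disjoint _ & B :|: _]]disjoint_sym disjoint_setU negb_and.
    rewrite disjoint_sym => /orP[le_t|->]; last by rewrite !orbT.
    rewrite disjoints1; have [vm|vm] /= := boolP (v \in _); first by rewrite !orbT.
    rewrite (leq_trans le_t) // subset_leq_card //; apply/subsetP => i.
    by rewrite !inE in vm *; case: (i =P v) => [->|//]; rewrite (negbTE vm).
  move=> g; rewrite inE => /eqP->; apply/monomial_idealX.
  by rewrite /veronese_pred mnm_suppU disjoints1 !inE eqxx orbT.
have idJ := ideal_adjoin_ideal (veronese t A B) [:: 'X_v].
move=> Vf; apply: ideal_of_msupp => // m /Vf; rewrite /veronese_pred.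
have [vm|vm] := boolP (v \in mnm_supp m).
  rewrite inE -lep1mP in vm; rewrite -(submK vm) mpolyXD => _.
  by apply/(idealMl idJ)/mem_ideal_adjoin; rewrite inE.
move=> Vm; apply/sub_ideal_adjoin/monomial_idealX; rewrite /veronese_pred.
case/orP: Vm => [le_t|].
  by rewrite (leq_trans le_t) // subset_leq_card // setIS // subD1set.
rewrite disjoint_sym disjoint_setU negb_and disjoints1 vm /=.
by rewrite disjoint_sym => ->; rewrite orbT.
Qed.

End Veronese.

Arguments veronese F {n} t A B _.
Arguments veronese_ideal F {n} t A B.

Section RegularSequences.
Variables (F : fieldType) (n : nat).
Local Notation S := {mpoly F[n]}.
Implicit Types (I J G : S -> Prop) (f g h u : S) (fs : seq S) (A B : {set 'I_n}).

Fixpoint weakly_regular I fs : Prop :=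
  if fs is f :: fs' then
    (forall g, I (f * g) -> I g) /\ weakly_regular (ideal_adjoin I [:: f]) fs'
  else True.

Lemma weakly_regularP I fs : is_ideal I -> weakly_regular I fs ->
  forall i, (i < size fs)%N -> forall g,
    ideal_adjoin I (take i fs) (nth 0 fs i * g) -> ideal_adjoin I (take i fs) g.
Proof.
elim: fs I => [//|f fs IH] I idI [regf regfs] [_|i lti] g /=.
  by rewrite ideal_adjoin_nil //; apply: regf.
rewrite -cat1s ideal_adjoin_cat; apply: IH => //; exact: ideal_adjoin_ideal.
Qed.

Lemma weakly_regular_full I fs : (forall g, I g) -> weakly_regular I fs.
Proof.
elim: fs I => [//|f fs IH] I fullI; split=> //.
by apply: IH => g; apply: sub_ideal_adjoin.
Qed.

Lemma colon_ideal I u : is_ideal I -> is_ideal (fun g => I (u * g)).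
Proof.
move=> idI; split=> [|f g If Ig|f g Ig].
- by rewrite mulr0; apply: ideal0.
- by rewrite mulrDr; apply: idealD.
- by rewrite mulrCA; apply: idealMl.
Qed.

Lemma ideal_adjoinC I f u :
  ideal_adjoin (ideal_adjoin I [:: f]) [:: u] = ideal_adjoin (ideal_adjoin I [:: u]) [:: f].
Proof.
rewrite -!ideal_adjoin_cat; apply: ideal_ext => g.
by split; apply: ideal_gen_min; try exact: ideal_adjoin_ideal;
  move=> h [Ih|]; [exact: sub_ideal_adjoin| |exact: sub_ideal_adjoin|];
  rewrite !inE => hfu; apply: mem_ideal_adjoin; rewrite !inE orbC.
Qed.

(* Regularity on both ends of
   [0 -> S/(I : u) -> S/I -> S/(I + (u)) -> 0] implies it in the middle. *)
Lemma weakly_regular_colon I u fs : is_ideal I ->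
  weakly_regular (fun g => I (u * g)) fs ->
  weakly_regular (ideal_adjoin I [:: u]) fs -> weakly_regular I fs.
Proof.
elim: fs I => [//|f fs IH] I idI [colf colfs] [adjf adjfs].
have idIu := colon_ideal u idI.
split=> [g Ifg|].
  (* Regularity modulo [I + (u)] gives [g = a * u] modulo [I]; then [u * (f * a)] is in [I], and
     regularity modulo [I : u] gives [u * a] in [I]. *)
  have /adjf/(ideal_adjoin1P u g idI)[a Ia] : ideal_adjoin I [:: u] (f * g).
    exact: sub_ideal_adjoin.
  suff Iua : I (u * a) by apply: (idealBr idI _ Ia); rewrite mulrC.
  apply: colf; rewrite (_ : _ * _ = f * g - f * (g - a * u)).
    by apply: idealB => //; apply: idealMl.
  by rewrite mulrBr opprB addrC subrK mulrC -mulrA.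
apply: IH; first exact: ideal_adjoin_ideal; last by rewrite ideal_adjoinC.
(* The induction needs [(I + (f)) : u = (I : u) + (f)]. If [u * g - a * f] is in [I], then [f * a],
   hence [a], is in [I + (u)]; with [a = b * u] modulo [I], the element [g - b * f] is in
   [I : u]. *)
suff -> : (fun g => ideal_adjoin I [:: f] (u * g)) = ideal_adjoin (fun g => I (u * g)) [:: f].
  by [].
apply: ideal_ext => g; rewrite !ideal_adjoin1P //; split=> [[a Ia]|[a Ia]]; last first.
  by exists (u * a); rewrite -mulrA -mulrBr.
have /adjf/(ideal_adjoin1P u a idI)[b Ib] : ideal_adjoin I [:: u] (f * a).
  apply/ideal_adjoin1P => //; exists g; rewrite -opprB [g * u]mulrC [f * a]mulrC.
  exact: idealN.
exists b; rewrite (_ : _ * _ = (u * g - a * f) + (a - b * u) * f).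
  by apply: idealD => //; rewrite mulrC; apply: idealMl.
by rewrite mulrBl addrA subrK mulrBr; congr (_ - _); rewrite mulrA [b * u]mulrC.
Qed.

(** For [t > 0] the numerical hypotheses make [s] the dimension of the quotient. Passing to the
    colon ideal frees [v] and lowers [t], adjoining ['X_v] moves [v] to [B]: both keep [s]. The
    outer induction is on [s], the inner one on [#|A|]. *)
Lemma weakly_regular_mesym s t A B : [disjoint A & B] ->
  (#|~: (A :|: B)| + t = s.+1)%N -> (t <= #|A|.+1)%N ->
  weakly_regular (veronese F t A B) [seq mesym n F i | i <- rev (iota 1 s)].
Proof.
elim: s t A B => [|s IHs] t A B //.
have -> : rev (iota 1 s.+1) = s.+1 :: rev (iota 1 s).
  by rewrite -{1}[s.+1]addn1 iotaD rev_cat /= add1n.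
rewrite map_cons.
have [k] := ubnP #|A|; elim: k t A B => // k IHk t A B; rewrite ltnS => leAk dAB eqs leA.
case: t => [|t] in eqs leA *; first by apply: weakly_regular_full => g m _.
have [ltA|] := ltnP t #|A|.
  have [v vA] : exists v, v \in A by apply/card_gt0P; lia.
  have vB : v \notin B by rewrite (disjointFr dAB vA).
  have cA : (#|A| = #|A :\ v|.+1)%N by rewrite (cardsD1 v) vA.
  apply: (@weakly_regular_colon _ 'X_v); first exact: veronese_ideal.
    rewrite veronese_colon //; apply: IHk; rewrite -?cA //.
      by apply: disjointWl dAB; apply: subD1set.
    have -> : ~: (A :\ v :|: B) = v |: ~: (A :|: B).
      by apply/setP => i; rewrite !inE; case: eqP => [->|//]; rewrite (negbTE vB).
    by rewrite cardsU1 !inE vA /= add1n addSnnS.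
  rewrite veronese_adjoin //; apply: IHk; rewrite -?cA //.
    rewrite -setI_eq0; apply/eqP/setP => i; rewrite !inE.
    by case: eqP => //= _; apply: contraTF dAB => /andP[iA iB];
      apply/pred0Pn; exists i; rewrite /= iA.
  have -> // : ~: (A :\ v :|: (v |: B)) = ~: (A :|: B).
  by apply/setP => i; rewrite !inE; case: eqP => [->|//]; rewrite vA.
(* Now [t.+1] exceeds [#|A|]: the ideal is generated by the variables in [B], and [s.+1] variables
   remain outside [B]. *)
move=> leAt; have eqt : t = #|A| by lia.
have cB : #|~: B| = s.+1.
  have -> : ~: B = A :|: ~: (A :|: B).
    apply/setP => i; rewrite !inE; case: (boolP (i \in A)) => //= iA.
    by rewrite (disjointFr dAB iA).
  rewrite cardsU; suff -> : A :&: ~: (A :|: B) = set0 by rewrite cards0; lia.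
  by apply/setP => i; rewrite !inE; case: (i \in A).
have predE m : veronese_pred t.+1 A B m = ~~ [disjoint mnm_supp m & B].
  by rewrite /veronese_pred eqt ltnNge subset_leq_card // subsetIr.
have idV := veronese_ideal F t.+1 A B.
(* Every squarefree monomial of degree [s.+1] other than the product over [~: B] involves a variable
   in [B]. *)
have Ve : veronese F t.+1 A B (mesym n F s.+1 - 'X_[mesym1 (~: B)]).
  rewrite mesymE (bigD1 (~: B)) ?cB //= addrC addrK; apply: ideal_sum => // C /andP[/eqP cC neC].
  apply/monomial_idealX; rewrite predE mnm_supp_mesym1; apply: contraNN neC.
  by rewrite disjoints_subset eqEcard cC cB leqnn andbT.
split=> [g Veg|].
  have : veronese F t.+1 A B ('X_[mesym1 (~: B)] * g).
    rewrite -[X in X * _](subKr (mesym n F s.+1)) mulrBl.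
    by apply: (idealB idV Veg); rewrite mulrC; apply: (idealMl idV).
  move/monomial_idealXM => Vg m /Vg; rewrite !predE mnm_suppD mnm_supp_mesym1 disjoint_setU.
  by rewrite disjoints_subset subxx.
(* Killing the product over [~: B] gives the Veronese ideal of degree [s.+1] on [~: B]. No variable
   is left outside [~: B] and [B], so the outer induction applies. *)
suff -> : ideal_adjoin (veronese F t.+1 A B) [:: mesym n F s.+1] = veronese F s.+1 (~: B) B.
  apply: IHs; first by rewrite disjoints_subset subxx.
    by rewrite setUC setUCr setCT cards0.
  by rewrite cB.
have idJ := ideal_adjoin_ideal (veronese F t.+1 A B) [:: mesym n F s.+1].
apply: ideal_ext => f; split=> [|Vf].
  apply: ideal_adjoin_min; first exact: veronese_ideal.
    by move=> g Vg m /Vg; rewrite predE /veronese_pred orbC => ->.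
  move=> g; rewrite inE => /eqP->; rewrite -(subrK 'X_[mesym1 (~: B)] (mesym n F s.+1)).
  apply: (idealD (veronese_ideal _ _ _ _)).
    by move=> m /Ve; rewrite predE /veronese_pred orbC => ->.
  by apply/monomial_idealX; rewrite /veronese_pred mnm_supp_mesym1 setIid cB leqnn.
apply: ideal_of_msupp => // m /Vf /orP[le_s|mB]; last first.
  by apply/sub_ideal_adjoin/monomial_idealX; rewrite predE.
have sub : ~: B \subset mnm_supp m.
  by apply/setIidPr/eqP; rewrite eqEcard subsetIr cB le_s.
rewrite -mesym1_le in sub; rewrite -(submK sub) mpolyXD; apply: idealMl => //.
rewrite -(subKr (mesym n F s.+1) 'X_[_]); apply: (idealB idJ).
  by apply: mem_ideal_adjoin; rewrite inE.
exact: sub_ideal_adjoin.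
Qed.

End RegularSequences.

(** * Upper bounds on dimension and depth *)

Section Dimension.
Variables (F : fieldType) (n : nat).
Local Notation S := {mpoly F[n]}.
Implicit Types (f g h : S) (A B U W : {set 'I_n}) (m : 'X_{1..n}).

(* Take the terms with lexicographically smallest exponent: at step [i] divide by the
   least power of [y i] and reduce modulo [y i]. *)
Lemma chain_algebraic_independence r M (K : nat -> S -> Prop) (y : 'I_r -> S)
    (c : {ffun 'I_r -> 'I_M} -> F) :
  (forall i, (i <= r)%N -> is_ideal (K i)) ->
  (forall (i : 'I_r) f, K i f -> K i.+1 f) ->
  (forall i : 'I_r, K i.+1 (y i)) ->
  (forall (i : 'I_r) g, K i (y i * g) -> K i g) ->
  ~ K r 1 ->
  K 0%N (\sum_a c a *: \prod_i y i ^+ a i) -> forall a, c a = 0.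
Proof.
move=> idK leK Ky regK K1 Kc a0; apply/eqP; apply: contra_notT K1 => ca0.
(* [Z] holds exponents tied in the first [i] coordinates; [K i] contains the sum of their terms,
   stripped of the factors [y j] with [j < i]. *)
have step i : (i <= r)%N -> exists Z : {set {ffun 'I_r -> 'I_M}},
    [/\ Z != set0, {in Z, forall a, c a != 0},
        {in Z &, forall (a b : {ffun 'I_r -> 'I_M}) (j : 'I_r), (j < i)%N -> a j = b j} &
        K i (\sum_(a in Z) c a *: \prod_(j < r | (i <= j)%N) y j ^+ a j)].
  elim: i => [_|i IH ltir].
    exists [set a | c a != 0]; split=> //.
    - by apply/set0Pn; exists a0; rewrite inE.
    - by move=> a; rewrite inE.
    rewrite (_ : \sum_(_ in _) _ = \sum_a c a *: \prod_i y i ^+ a i) //.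
    rewrite [RHS](bigID [pred a | c a != 0]) /= [X in _ = _ + X]big1 ?addr0.
      by apply: eq_big => [a|//]; rewrite inE.
    by move=> a; rewrite negbK => /eqP->; rewrite scale0r.
  have [Z [Z0 cZ agZ KZ]] := IH (ltnW ltir).
  pose io := Ordinal ltir.
  have [a1 a1Z] := set0Pn _ Z0.
  have [am amZ minZ] := arg_minnP (fun a : {ffun 'I_r -> 'I_M} => nat_of_ord (a io)) a1Z.
  have idi : is_ideal (K i.+1) by apply: idK.
  pose rest (a : {ffun 'I_r -> 'I_M}) := \prod_(j < r | (i < j)%N) y j ^+ a j.
  have prodE a : a \in Z -> \prod_(j < r | (i <= j)%N) y j ^+ a j =
      y io ^+ am io * (y io ^+ (a io - am io) * rest a).
    move=> aZ; rewrite (bigD1 io) //= mulrA -exprD subnKC; last exact: minZ.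
    congr (_ * _); apply: eq_bigl => j.
    by rewrite [in RHS]ltn_neqAle andbC -val_eqE eq_sym.
  have Kdiv k g : K i (y io ^+ k * g) -> K i g.
    elim: k => [|k IHk]; first by rewrite expr0 mul1r.
    by rewrite exprS -mulrA => /(regK io)/IHk.
  have {KZ} KZ : K i.+1 (\sum_(a in Z) c a *: (y io ^+ (a io - am io) * rest a)).
    apply/(leK io)/(Kdiv (am io)); move: KZ; rewrite mulr_sumr.
    rewrite (_ : \sum_(_ in _) _ =
       \sum_(a in Z) y io ^+ am io * (c a *: (y io ^+ (a io - am io) * rest a))) //.
    by apply: eq_bigr => a aZ; rewrite prodE // -scalerAr.
  exists [set a in Z | a io == am io]; split.
  - by apply/set0Pn; exists am; rewrite inE eqxx andbT.
  - by move=> a; rewrite inE => /andP[/cZ].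
  - move=> a b; rewrite !inE => /andP[aZ /eqP aio] /andP[bZ /eqP bio] j.
    rewrite ltnS leq_eqVlt => /orP[/eqP ji|]; last exact: agZ.
    by rewrite (_ : j = io) ?aio ?bio //; apply: val_inj.
  move: KZ; rewrite (bigID (fun a : {ffun _ -> _} => a io == am io)) /= => KZ.
  rewrite (_ : \sum_(_ in _) _ =
    \sum_(a in Z | a io == am io) c a *: (y io ^+ (a io - am io) * rest a)); last first.
    apply: eq_big => a; rewrite inE // => /andP[aZ /eqP ->].
    by rewrite subnn mul1r.
  suff Krest : K i.+1 (\sum_(a in Z | a io != am io)
      c a *: (y io ^+ (a io - am io) * rest a)).
    by have := idealB idi KZ Krest; rewrite addrK.
  apply: (ideal_sum idi) => a /andP[aZ neqa].
  apply: (idealZ idi); rewrite mulrC; apply: (idealMl idi).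
  have : (0 < a io - am io)%N.
    by rewrite subn_gt0 ltn_neqAle eq_sym minZ // andbT -val_eqE in neqa *.
  by case: (_ - _)%N => // k _; rewrite exprSr; apply: (idealMl idi); apply: (Ky io).
(* At [i = r] a single exponent is left, with an empty product: a nonzero constant lies in [K r]. *)
have [Z [/set0Pn[a aZ] cZ agZ]] := step r (leqnn r).
have -> : Z = [set a].
  apply/setP => b; rewrite inE; apply/idP/eqP => [bZ|->//].
  by apply/ffunP => j; apply: agZ.
rewrite big_set1 big_pred0 => [Kca|j]; last by rewrite leqNgt ltn_ord.
rewrite -(scale1r (1 : S)) -(mulVf (cZ a aZ)) -scalerA.
exact: (idealZ (idK r (leqnn r))).
Qed.

Lemma mdeg_msupp_prod (I : Type) (s : seq I) (y : I -> S) (a : I -> nat) E :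
  (forall i, {in msupp (y i), forall m, mdeg m <= E}%N) ->
  {in msupp (\prod_(i <- s) y i ^+ a i), forall m, mdeg m <= \sum_(i <- s) a i * E}%N.
Proof.
move=> yE; elim/big_rec2: _ => [m|i e f _ IH m].
  by rewrite msupp1 inE => /eqP->; rewrite mdeg0.
case/msuppM_le/allpairsP => -[m1 m2] /= [m1y /IH le2 ->].
rewrite mdegD leq_add // {le2}.
elim: (a i) m1 m1y => [|k IHk] m1.
  by rewrite expr0 msupp1 inE => /eqP->; rewrite mdeg0.
rewrite exprS => /msuppM_le/allpairsP[[m3 m4] /= [/yE le3 /IHk le4 ->]].
by rewrite mdegD mulSn leq_add.
Qed.

Lemma card_bigcup_le (T J : finType) (P : pred J) (E : J -> {set T}) :
  (#|\bigcup_(j | P j) E j| <= \sum_(j | P j) #|E j|)%N.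
Proof.
elim/big_rec2: _ => [|j k X _ le]; first by rewrite cards0.
by rewrite (leq_trans (leq_card_setU _ _)) // leq_add2l.
Qed.

(** These are the exponents of the monomials outside [veronese F t W set0] with all entries below
    [N]. *)
Definition bounded_exponents t W N : {set {ffun 'I_n -> 'I_N}} :=
  [set e : {ffun 'I_n -> 'I_N} | (#|[set i | e i != 0%N :> nat] :&: W| < t)%N].

(** Such a support has fewer than [t] elements in [W] and at most [n - #|W|] outside, hence lies in
    a set of at most [d] variables. There are at most [2 ^ n] such sets, each carrying at most
    [N.+1 ^ d] exponents. *)
Lemma card_bounded_exponents t W N d : (n + t <= d.+1 + #|W|)%N ->
  (#|bounded_exponents t W N.+1| <= 2 ^ n * N.+1 ^ d)%N.
Proof.
move=> led.
pose E U := [set e : {ffun 'I_n -> 'I_N.+1} in pffun_on ord0 (mem U) predT].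
have sub : bounded_exponents t W N.+1 \subset \bigcup_(U : {set 'I_n} | (#|U| <= d)%N) E U.
  apply/subsetP => e; rewrite inE; set V := [set i | _] => ltVt.
  apply/bigcupP; exists ((V :&: W) :|: ~: W).
    have [leU _] := leq_card_setU (V :&: W) (~: W); apply: leq_trans leU _.
    rewrite -(leq_add2r #|W|) -addnA [(#|~: W| + _)%N]addnC cardsC card_ord -ltnS -!addSn.
    by rewrite (leq_trans _ led) // addnC leq_add2l.
  rewrite inE; apply/pffun_onP; split=> //; apply/subsetP => i ei.
  by rewrite !inE; case: (i \in W); rewrite ?orbT // andbT orbF.
rewrite (leq_trans (subset_leq_card sub)) // (leq_trans (card_bigcup_le _ _)) //.
rewrite (@leq_trans (\sum_(U : {set 'I_n}) N.+1 ^ d)) //.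
  rewrite big_mkcond leq_sum // => U _; case: ifP => // leU.
  by rewrite cardsE card_pffun_on cardT size_enum_ord leq_pexp2l.
by rewrite sum_nat_const -cardsT -powersetT card_powerset cardsT card_ord.
Qed.

(** There are [M ^ r] products with exponents below [M], while modulo the ideal they involve a
    number of monomials bounded by a constant times [M ^ d]. Since [d < r], a large [M] forces a
    linear relation. *)
Lemma veronese_algebraic_dependence t W d r (y : 'I_r -> S) :
  (n + t <= d.+1 + #|W|)%N -> (d < r)%N ->
  exists M (c : {ffun 'I_r -> 'I_M} -> F), (exists a, c a != 0) /\
    veronese F t W set0 (\sum_a c a *: \prod_i y i ^+ a i).
Proof.
move=> led ltdr.
pose E := \max_i msize (y i).
have yE i : {in msupp (y i), forall m, (mdeg m <= E)%N}.
  by move=> m /msize_mdeg_lt/ltnW le; exact: leq_trans le (leq_bigmax i).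
(* [N] bounds the degrees of the products, and [N.+1 <= M * (r * E).+1]; this [M] thus makes
   [2 ^ n * N.+1 ^ d] smaller than [M ^ d.+1]. *)
pose M := (2 ^ n * (r * E).+1 ^ d).+1; pose N := (M * (r * E))%N.
pose mon (a : {ffun 'I_r -> 'I_M}) := \prod_i y i ^+ a i.
have degm a m : m \in msupp (mon a) -> (mdeg m < N.+1)%N.
  move/(mdeg_msupp_prod yE) => le; rewrite ltnS (leq_trans le) //.
  rewrite (@leq_trans (\sum_(i < r) M * E)) //.
    by apply: leq_sum => i _; rewrite leq_mul2r ltnW ?orbT.
  by rewrite sum_nat_const card_ord /N mulnCA.
pose T := bounded_exponents t W N.+1.
pose X := \matrix_(i < #|{ffun 'I_r -> 'I_M}|, j < #|T|)
  (mon (enum_val i))@_[multinom (enum_val j k : nat) | k < n].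
have ltTM : (#|T| < #|{ffun 'I_r -> 'I_M}|)%N.
  rewrite card_ffun !card_ord (leq_ltn_trans (card_bounded_exponents _ led)) //.
  rewrite (@leq_trans (M ^ d.+1)) ?leq_pexp2l // expnS.
  rewrite (@leq_ltn_trans (2 ^ n * (M * (r * E).+1) ^ d)) //.
    have leN : (N.+1 <= M * (r * E).+1)%N by rewrite mulnS -[N.+1]add1n leq_add2r.
    rewrite leq_mul2l; apply/orP; right.
    by elim: (d) => // k IHk; rewrite !expnS leq_mul.
  by rewrite expnMn mulnCA mulnC ltn_pmul2r ?expn_gt0.
have : kermx X != 0.
  by rewrite -mxrank_eq0 mxrank_ker subn_eq0 -ltnNge (leq_ltn_trans (rank_leq_col X)).
case/rowV0Pn => u /sub_kermxP uX u0.
exists M, (fun a => u 0 (enum_rank a)); split.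
  have /rV0Pn[j uj] := u0; exists (enum_val j); by rewrite enum_valK.
move=> m mP; rewrite /veronese_pred -setI_eq0 setI0 eqxx orbF leqNgt.
apply: contraTN mP => ltt; rewrite mcoeff_msupp negbK raddf_sum /=.
have [lem|ltm] := ltnP (mdeg m) N.+1; last first.
  rewrite big1 // => a _; rewrite mcoeffZ (memN_msupp_eq0 (m := m)) ?mulr0 //.
  by apply: contraTN ltm => /degm; rewrite -ltnNge.
have ltm i : (m i < N.+1)%N.
  by apply: leq_ltn_trans lem; rewrite mdegE (bigD1 i) //= leq_addr.
pose e := [ffun i => Ordinal (ltm i)].
have eT : e \in T.
  rewrite inE (_ : [set i | _] = mnm_supp m) //.
  by apply/setP => i; rewrite !inE ffunE.
have em : [multinom (e k : nat) | k < n] = m by apply/mnmP => i; rewrite mnmE ffunE.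
move/matrixP/(_ 0 (enum_rank_in eT e)): uX; rewrite !mxE => uX.
apply/eqP; rewrite -[RHS]uX (reindex (@enum_val {ffun 'I_r -> 'I_M} predT)) /=; last first.
  by exists enum_rank => a _; [apply: enum_valK | apply: enum_rankK].
by apply: eq_bigr => j _; rewrite mcoeffZ enum_valK !mxE enum_rankK_in // em.
Qed.

(** This serves both upper bounds: [K i] is either the ideal enlarged by the first [i] terms of a
    regular sequence, or the [i]-th prime of a chain, with [y i] a new element of the next prime. *)
Lemma veronese_chain_le t W d r (K : nat -> S -> Prop) (y : 'I_r -> S) :
  (n + t <= d.+1 + #|W|)%N ->
  (forall i, (i <= r)%N -> is_ideal (K i)) ->
  (forall (i : 'I_r) f, K i f -> K i.+1 f) ->
  (forall i : 'I_r, K i.+1 (y i)) ->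
  (forall (i : 'I_r) g, K i (y i * g) -> K i g) ->
  ~ K r 1 -> (forall f, veronese F t W set0 f -> K 0%N f) -> (r <= d)%N.
Proof.
move=> led idK leK Ky regK K1 VK; rewrite leqNgt; apply/negP => ltdr.
have [M [c [[a /eqP ca] /VK Kc]]] := veronese_algebraic_dependence y led ltdr.
exact/ca/(chain_algebraic_independence idK leK Ky regK K1 Kc).
Qed.

End Dimension.

(** * Cohen-Macaulayness *)

Section CohenMacaulay.
Variables (F : fieldType) (n : nat).
Local Notation S := {mpoly F[n]}.
Implicit Types (f g h : S) (A B U : {set 'I_n}) (m : 'X_{1..n}).

Definition variable_ideal U : S -> Prop :=
  monomial_ideal (fun m => ~~ [disjoint mnm_supp m & U]).

Lemma variable_ideal_ideal U : is_ideal (variable_ideal U).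
Proof.
apply: monomial_ideal_ideal => m1 m2.
by rewrite mnm_suppD disjoint_setU negb_and => ->; rewrite orbT.
Qed.

(** Remove from both factors the terms lying in the ideal. The product of what remains is in the
    ideal, but its monomials avoid [U]; so it vanishes, and one of the two remainders is zero. *)
Lemma variable_ideal_prime U : is_prime_ideal (variable_ideal U).
Proof.
have idU := variable_ideal_ideal U; split=> // [/(_ 0%MM)|f g Ufg].
  by rewrite msupp1 inE eqxx => /(_ isT); rewrite mnm_supp0 -setI_eq0 set0I eqxx.
pose p m := ~~ [disjoint mnm_supp m & U].
have [[f1 f2] /= ef [f1p f2p]] := mpoly_split p f.
have [[g1 g2] /= eg [g1p g2p]] := mpoly_split p g.
have Uf1 : variable_ideal U f1 by move=> m /f1p[].
have Ug1 : variable_ideal U g1 by move=> m /g1p[].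
have /eqP : f2 * g2 = 0.
  apply/msuppnil0/eqP; rewrite -size_eq0 size_eq0; case E : (msupp _) => [//|m s].
  have mfg : m \in msupp (f2 * g2) by rewrite E mem_head.
  have [[m1 m2] /= [m1f m2g em]] := allpairsP (msuppM_le mfg).
  have : variable_ideal U (f2 * g2).
    have -> : f2 * g2 = f * g - (f1 * g + f2 * g1).
      by rewrite ef eg !mulrDl !mulrDr !opprD; ring.
    apply: (idealB idU Ufg); apply: (idealD idU); last exact: (idealMl idU).
    by rewrite mulrC; apply: (idealMl idU).
  move=> /(_ m mfg); rewrite em mnm_suppD disjoint_setU.
  by have [+ _] := f2p _ m1f; have [+ _] := g2p _ m2g; rewrite /p !negbK => -> ->.
rewrite mulf_eq0 => /orP[] /eqP e0; [left; rewrite ef | right; rewrite eg];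
  by rewrite e0 addr0.
Qed.

Lemma variable_idealX U v : v \in U -> variable_ideal U 'X_v.
Proof. by move=> vU; apply/monomial_idealX; rewrite mnm_suppU disjoints1 vU. Qed.

Lemma variable_idealXN U v : v \notin U -> ~ variable_ideal U 'X_v.
Proof. by move=> vU /monomial_idealX; rewrite mnm_suppU disjoints1 vU. Qed.

Lemma variable_idealS U1 U2 f : U1 \subset U2 ->
  variable_ideal U1 f -> variable_ideal U2 f.
Proof.
by move=> sub If m /If; apply: contraNN => dis; apply: disjointWr dis.
Qed.

Lemma irrelevant_ideal_ideal : is_ideal (@irrelevant_ideal F n).
Proof.
split=> [|f g f0 g0|f g g0]; rewrite /irrelevant_ideal.
- exact: mcoeff0.
- by rewrite mcoeffD f0 g0 addr0.
- by rewrite rmorphM /= g0 mulr0.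
Qed.

Lemma veronese_irrelevant t A f : (0 < t)%N ->
  veronese F t A set0 f -> irrelevant_ideal f.
Proof.
move=> t0 Vf; apply/eqP; rewrite mcoeff_eq0; apply/negP => /Vf.
by rewrite /veronese_pred -!setI_eq0 setI0 eqxx orbF mnm_supp0 set0I cards0 leqNgt t0.
Qed.

Lemma card_ord_lt k : (k <= n)%N -> #|[set i : 'I_n | (i < k)%N]| = k.
Proof.
move=> lekn; rewrite -sum1dep_card.
by rewrite -(big_ord_widen n (fun=> 1%N) lekn) sum_nat_const card_ord muln1.
Qed.

End CohenMacaulay.

Section StarCohenMacaulay.
Variables (F : fieldType) (n t : nat).
Local Notation S := {mpoly F[n.+1]}.
Local Notation W := [set~ ord_max : 'I_n.+1].
Local Notation I := (veronese F t W set0).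
Hypotheses (t_gt0 : (0 < t)%N) (le_tn : (t <= n)%N).

Let cardW : #|W| = n. Proof. by rewrite cardsC1 card_ord. Qed.

Lemma krull_dim_veronese : krull_dim I t.
Proof.
split; last first.
  move=> d [P [primeP chainP]].
  have idP i : (i <= d)%N -> is_ideal (P i) by move=> /primeP[[]].
  have /fin_all_exists[y yP] (i : 'I_d) : exists f, P i.+1 f /\ ~ P i f.
    by have [_ [f]] := chainP _ (ltn_ord i); exists f.
  apply: (@veronese_chain_le F n.+1 t W t d P y) => //.
  - by rewrite cardW; lia.
  - by move=> i; have [] := chainP _ (ltn_ord i).
  - by move=> i; have [] := yP i.
  - move=> i g; have [_ yN] := yP i.
    by have [[_ _ prP] _] := primeP _ (ltnW (ltn_ord i)); case/prP.
  - by have [[]] := primeP d (leqnn d).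
  - by have [] := primeP 0%N (leq0n d).
(* [U 0] consists of [n - t + 1] leaves, so only [t - 1] leaves remain and every generator meets it.
   One variable is added at a time until [U t] contains them all. *)
pose U i : {set 'I_n.+1} := [set j : 'I_n.+1 | (j < (n - t).+1 + i)%N].
exists (fun i => variable_ideal (U i)); split=> [i _|i ltit].
  split=> [|f If m /If]; first exact: variable_ideal_prime.
  rewrite /veronese_pred -setI_eq0 setI0 eqxx orbF; apply: contraL => dis.
  rewrite -ltnNge; pose L : {set 'I_n.+1} := [set j : 'I_n.+1 | (j < (n - t).+1)%N].
  have cL : #|L| = (n - t).+1 by apply: card_ord_lt; lia.
  have LW : L \subset W.
    by apply/subsetP => j; rewrite !inE => ltj; apply/eqP => ej; rewrite ej /= in ltj; lia.
  have : mnm_supp m :&: W \subset W :\: L.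
    apply/subsetP => j /setIP[jm jW]; rewrite inE jW andbT.
    apply: contraTN jm => jL; rewrite disjoint_sym in dis.
    rewrite (disjointFr dis) //; rewrite !inE in jL *; exact: ltn_addr.
  move/subset_leq_card => le; apply: leq_ltn_trans le _.
  by rewrite cardsD (setIidPr LW) cL cardW; lia.
split=> [f|].
  by apply: variable_idealS; apply/subsetP => j; rewrite !inE addnS; lia.
have ltv : ((n - t).+1 + i < n.+1)%N by lia.
exists 'X_(Ordinal ltv); first by apply: variable_idealX; rewrite inE /= addnS.
by apply: variable_idealXN; rewrite inE /= ltnn.
Qed.

Lemma depth_veronese : depth I t.
Proof.
have idI := veronese_ideal F t W set0.
split; last first.
  move=> fs [_ regfs fs1].
  apply: (@veronese_chain_le F n.+1 t W t (size fs)
    (fun i => ideal_adjoin I (take i fs)) (fun i => nth 0 fs i)).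
  - by rewrite cardW; lia.
  - by move=> i _; apply: ideal_adjoin_ideal.
  - move=> i f; rewrite (take_nth 0) ?ltn_ord // -cats1 ideal_adjoin_cat.
    exact: sub_ideal_adjoin.
  - by move=> i; apply: mem_ideal_adjoin; rewrite (take_nth 0) ?ltn_ord // mem_rcons mem_head.
  - by move=> i g; apply: regfs.
  - by rewrite take_size.
  - by move=> f; apply: sub_ideal_adjoin.
(* The centre occurs in no generator, so its variable comes first; the elementary symmetric
   polynomials then supply the other [t - 1] terms. *)
pose fs := 'X_ord_max :: [seq mesym n.+1 F i | i <- rev (iota 1 t.-1)].
exists fs; last by rewrite /= size_map size_rev size_iota prednK.
have fs_irr f : f \in fs -> irrelevant_ideal f.
  rewrite inE => /orP[/eqP->|/mapP[i]]; first by rewrite /irrelevant_ideal mcoeffX mnm1_eq0.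
  rewrite mem_rev mem_iota => /andP[i0 _] ->; rewrite /irrelevant_ideal mcoeff_mesym.
  by rewrite /mechar mdeg0; case: i i0.
split=> //; last first.
  move/(ideal_adjoin_min (irrelevant_ideal_ideal F n.+1)) => irr1.
  have : irrelevant_ideal (1 : S) by apply: irr1 => // g; apply: veronese_irrelevant.
  by rewrite /irrelevant_ideal mcoeff1 eqxx => /eqP; rewrite oner_eq0.
apply: (weakly_regularP idI); split=> [g Ig|].
  move=> m mg; have /Ig : (U_(ord_max) + m)%MM \in msupp ('X_ord_max * g).
    exact/msuppXM/map_f.
  rewrite /veronese_pred mnm_suppD mnm_suppU setIUl.
  have -> : [set ord_max] :&: W = set0 by apply/setP => j; rewrite !inE; case: eqP.
  by rewrite set0U -!setI_eq0 !setI0.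
(* With the centre moved to [B] no variable is free, so [weakly_regular_mesym] applies with
   [s = t - 1]. *)
rewrite veronese_adjoin setU0.
have -> : W :\ ord_max = W by apply/setP => j; rewrite !inE; case: eqP.
apply: weakly_regular_mesym.
- by rewrite -setI_eq0; apply/eqP/setP => j; rewrite !inE; case: eqP.
- rewrite prednK // (_ : ~: _ = set0) ?cards0 //.
  by apply/setP => j; rewrite !inE; case: eqP.
- by rewrite cardW; lia.
Qed.

Lemma cohen_macaulay_veronese : cohen_macaulay I.
Proof. by exists t; [apply: krull_dim_veronese | apply: depth_veronese]. Qed.

End StarCohenMacaulay.

(** * Linear resolutions *)

Section LinearResolutions.
Variables (F : fieldType) (n : nat).
Local Notation S := {mpoly F[n]}.
Implicit Types (I J : S -> Prop) (f : S).

(* A resolution of the ideal [I] itself, whose [i]-th free module is generated in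
   degree [s + i]. *)
Record linear_free_resolution I (s : nat) := LinearFreeResolution {
  lr_rank : nat -> nat;
  lr_aug : 'cV[S]_(lr_rank 0);
  lr_diff : forall i, 'M[S]_(lr_rank i.+1, lr_rank i);
  lr_aug_homog : forall a, lr_aug a 0 \is s.-homog;
  lr_diff_homog : forall i a b, lr_diff i a b \is 1.-homog;
  lr_augP : forall f, I f <-> exists v : 'rV[S]_(lr_rank 0), f = (v *m lr_aug) 0 0;
  lr_exact0 : forall v : 'rV[S]_(lr_rank 0),
    v *m lr_aug = 0 <-> exists w : 'rV[S]_(lr_rank 1), v = w *m lr_diff 0%N;
  lr_exact : forall i (v : 'rV[S]_(lr_rank i.+1)),
    v *m lr_diff i = 0 <-> exists w : 'rV[S]_(lr_rank i.+2), v = w *m lr_diff i.+1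
}.

Arguments lr_augP {I s} l f.
Arguments lr_exact0 {I s} l v.
Arguments lr_exact {I s} l i v.

(** Putting [S] in degree 0 in front of a resolution of [I] resolves [S/I]. For [i >= 1] the [i]-th
    module has no basis vector of degree other than [s + i - 1], so Tor vanishes there. *)
Lemma linear_resolution_of I s : is_ideal I -> (0 < s)%N ->
  linear_free_resolution I s -> linear_resolution I.
Proof.
move=> idI s_gt0 [r aug d aug_homog d_homog augP ex0 ex].
exists s => //; split=> [f|i j i_gt0 neqj].
  split; last by apply: ideal_gen_min => // g [].
  move=> /augP[v ->]; rewrite mxE; exists (r 0%N), (fun k => v 0 k), (fun k => aug k 0).
  split=> // k; split; last exact: aug_homog.
  by apply/augP; exists (delta_mx 0 k); rewrite -rowE mxE.
pose rank i := if i is i'.+1 then r i' else 1%N.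
pose deg i (_ : 'I_(rank i)) := if i is i'.+1 then (s + i')%N else 0%N.
pose diff i : 'M[S]_(rank i.+1, rank i) :=
  match i with 0 => aug | i'.+1 => d i' end.
have R : {R : graded_free_resolution I | forall i', gr_gens R i'.+1 j = [set a | (s + i')%N == j]}.
  unshelve eexists.
    apply: (@GradedFreeResolution _ _ I rank deg 1%:M diff).
    - by move=> a; rewrite mxE ord1 eqxx dhomog1.
    - move=> [|k] a b _ /=; first by rewrite addn0 subn0 ord1.
      by rewrite addnS leqnSn subSnn.
    - move=> f; exists f%:M; rewrite mulmx1 mxE eqxx mulr1n subrr; exact: ideal0.
    - move=> v; rewrite mulmx1; split=> [/augP[w e]|[w ->]]; last by apply/augP; exists w.
      by exists w; apply/matrixP => a b; rewrite !ord1.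
    - by move=> [|k] v /=; [apply: ex0 | apply: ex].
  by move=> i'.
case: R => R gensE; exists R; rewrite /dim_tor.
case: i i_gt0 neqj => // i _ neqj; apply/eqP.
rewrite subn_eq0 (leq_trans (rank_leq_row _)) // (@leq_trans 0%N) // gensE.
rewrite (_ : [set _ | _] = set0) ?cards0 //; apply/setP => a; rewrite !inE.
by apply/eqP => e; apply: neqj; rewrite -e addnS subn1.
Qed.

Lemma pihomogM c e (f g : S) : g \is e.-homog ->
  pihomog mdeg (c + e)%N (f * g) = pihomog mdeg c f * g.
Proof.
move=> homg; pose k := maxn (msize f) c.+1.
have ltck : (c < k)%N by rewrite leq_max ltnS leqnn orbT.
rewrite [in LHS](@pihomog_partitionE _ _ mdeg k f) ?leq_maxl //.
rewrite mulr_suml raddf_sum /= (bigD1 (Ordinal ltck)) //= big1 ?addr0 => [|i nei].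
  by apply: pihomog_dE; apply: dhomogM => //; apply: pihomogP.
rewrite (@pihomog_ne0 _ _ mdeg (i + e)%N) ?eqn_add2r //.
by apply: dhomogM => //; apply: pihomogP.
Qed.

(** The given lifts may be inhomogeneous; since [A] and [N] are homogeneous, the degree 1 components
    of their entries still form a lift. *)
Lemma homog_lift l p q (A : 'M[S]_(l, q)) (N : 'M[S]_(p, q)) e :
  (forall k j, N k j \is e.-homog) -> (forall i j, A i j \is e.+1.-homog) ->
  (forall i, exists w, row i A = w *m N) ->
  exists2 X : 'M[S]_(l, p), (forall i k, X i k \is 1.-homog) & A = X *m N.
Proof.
move=> homN homA /fin_all_exists[w wE].
exists (\matrix_(i, k) pihomog mdeg 1 (w i 0 k)) => [i k|].
  by rewrite mxE; apply: pihomogP.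
apply/matrixP => i j; rewrite -[LHS](pihomog_dE (homA i j)).
have := congr1 (fun r : 'rV_q => r 0 j) (wE i); rewrite !mxE => ->.
rewrite raddf_sum /=; apply: eq_bigr => k _.
by rewrite mxE -[e.+1]add1n pihomogM.
Qed.

(** Comparison maps at different stages have different matrix types and are only known to exist, so
    a choice principle for dependent families assembles them. *)
Lemma dependent_choice (T : nat -> Type) (P : forall i, T i -> Prop)
    (R : forall i, T i -> T i.+1 -> Prop) :
  (exists x, P 0%N x) -> (forall i x, P i x -> exists2 y, P i.+1 y & R i x y) ->
  exists u : forall i, T i, forall i, P i (u i) /\ R i (u i) (u i.+1).
Proof.
move=> /constructive_indefinite_description[x0 Px0] step.
have next i (x : {x | P i x}) : {y : {y | P i.+1 y} | R i (sval x) (sval y)}.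
  apply: constructive_indefinite_description.
  by have [y Py Rxy] := step i _ (svalP x); exists (exist _ y Py).
pose u := nat_rect (fun i => {x | P i x}) (exist _ x0 Px0) (fun i x => sval (next i x)).
exists (fun i => sval (u i)) => i; split; first exact: (svalP (u i)).
exact: (svalP (next i (u i))).
Qed.

Section Properties.
Variables (I : S -> Prop) (s : nat) (R : linear_free_resolution I s).

Lemma lr_diff_aug : lr_diff R 0%N *m lr_aug R = 0.
Proof.
apply/row_matrixP => a; rewrite row_mul row0; apply/(lr_exact0 R).
by exists (delta_mx 0 a); rewrite rowE.
Qed.

Lemma lr_diff_diff i : lr_diff R i.+1 *m lr_diff R i = 0.
Proof.
apply/row_matrixP => a; rewrite row_mul row0; apply/(lr_exact R).
by exists (delta_mx 0 a); rewrite rowE.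
Qed.

Lemma lr_mem (v : 'rV_(lr_rank R 0)) : I ((v *m lr_aug R) 0 0).
Proof. by apply/(lr_augP R); exists v. Qed.

End Properties.

Arguments lr_mem {I s} R v.

(** The inclusion lifts stage by stage through the exactness of [H]. Generators of [G] sit one
    degree above those of [H], whence entries of degree 1. *)
Lemma comparison_map I J s (G : linear_free_resolution I s.+1)
    (H : linear_free_resolution J s) : (forall f, I f -> J f) ->
  exists phi : forall i, 'M[S]_(lr_rank G i, lr_rank H i),
    [/\ forall i a b, phi i a b \is 1.-homog, lr_aug G = phi 0%N *m lr_aug H
      & forall i, lr_diff G i *m phi i = phi i.+1 *m lr_diff H i].
Proof.
move=> IJ.
(* Besides homogeneity, [P] records the relation that makes [lr_diff G i *m X] a cycle of [H], so
   that the next map exists. *)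
pose P i : 'M[S]_(lr_rank G i, lr_rank H i) -> Prop :=
  match i with
  | 0 => fun X => (forall a b, X a b \is 1.-homog) /\ lr_aug G = X *m lr_aug H
  | i'.+1 => fun X => (forall a b, X a b \is 1.-homog) /\
                      lr_diff G i'.+1 *m X *m lr_diff H i' = 0
  end.
have hom_mul l p q (A : 'M[S]_(l, p)) (B : 'M[S]_(p, q)) :
    (forall a b, A a b \is 1.-homog) -> (forall a b, B a b \is 1.-homog) ->
    forall a b, (A *m B) a b \is 2.-homog.
  by move=> homA homB a b; rewrite mxE; apply: rpred_sum => k _; apply: (@dhomogM _ _ _ 1 _ 1).
have [||phi phiP] := @dependent_choice _ P
  (fun i X Y => lr_diff G i *m X = Y *m lr_diff H i).
- have [||a|X homX eX] := @homog_lift _ _ _ (lr_aug G) (lr_aug H) s.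
  + by move=> k j; rewrite ord1; apply: lr_aug_homog.
  + by move=> k j; rewrite ord1; apply: lr_aug_homog.
  + have /IJ/(lr_augP H)[w e] := lr_mem G (delta_mx 0 a).
    by exists w; rewrite rowE; apply/matrixP => k j; rewrite !ord1.
  by exists X.
- move=> i X PX; have homX : forall a b, X a b \is 1.-homog by case: i X PX => [|i] X [].
  have [||a|Y homY eY] := @homog_lift _ _ _ (lr_diff G i *m X) (lr_diff H i) 1.
  + exact: lr_diff_homog.
  + by apply: hom_mul => //; apply: lr_diff_homog.
  + case: i X a PX {homX} => [|i] X a [_ eX].
      by apply/(lr_exact0 H); rewrite -row_mul -mulmxA -eX lr_diff_aug row0.
    by apply/(lr_exact H); rewrite -row_mul eX row0.
  exists Y => //=; split=> //.
  by rewrite -mulmxA -eY mulmxA lr_diff_diff mul0mx.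
exists phi; split=> [i||i]; last by case: (phiP i).
- by have [] := phiP i; case: i (phi i) => [|i] X [].
- by have [[]] := phiP 0%N.
Qed.

Lemma free_linear_resolution I s r0 (aug : 'cV[S]_r0) :
  (forall a, aug a 0 \is s.-homog) ->
  (forall f, I f <-> exists v : 'rV[S]_r0, f = (v *m aug) 0 0) ->
  (forall v : 'rV[S]_r0, v *m aug = 0 -> v = 0) ->
  linear_free_resolution I s.
Proof.
move=> homa augP inj.
pose rank i := if i is _.+1 then 0%N else r0.
apply: (@LinearFreeResolution I s rank aug (fun=> 0)) => //.
- by move=> i a b; rewrite mxE rpred0.
- move=> v; split=> [/inj->|[w ->]]; last by rewrite mulmx0 mul0mx.
  by exists 0; rewrite mulmx0.
- move=> i v; split=> _; last by rewrite mulmx0.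
  by exists 0; rewrite mulmx0; apply: thinmx0.
Qed.

(** * The mapping cone resolving [C = I + x J] *)

Section MappingCone.
Variables (I J C : S -> Prop) (s : nat) (x : S).
Hypothesis homx : x \is 1.-homog.
Hypotheses (regx : forall f, I (x * f) -> I f).
Hypothesis (CP : forall f, C f <-> exists a b, [/\ I a, J b & f = a + x * b]).
Variables (G : linear_free_resolution I s.+1) (H : linear_free_resolution J s).
Variable phi : forall i, 'M[S]_(lr_rank G i, lr_rank H i).
Hypotheses (phi_homog : forall i a b, phi i a b \is 1.-homog).
Hypotheses (phi_aug : lr_aug G = phi 0%N *m lr_aug H).
Hypotheses (phi_diff : forall i, lr_diff G i *m phi i = phi i.+1 *m lr_diff H i).

(** The cone of [0 -> I -> I + J -> C -> 0] (direct sum in the middle), with maps [a |-> (- x a, a)]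
    and [(a, b) |-> a + x b]. The blocks are [H] for [J], [G] for [I] in the middle, and [G] shifted
    by one step for the kernel. *)
Let shift i := if i is i'.+1 then lr_rank G i' else 0%N.
Let rank i := (lr_rank H i + lr_rank G i + shift i)%N.
Let bd i : 'M[S]_(lr_rank G i, shift i) :=
  match i with 0 => 0 | i'.+1 => - lr_diff G i' end.
Let aug : 'cV[S]_(rank 0) := col_mx (col_mx (x *: lr_aug H) (lr_aug G)) 0.
Let diff i : 'M[S]_(rank i.+1, rank i) :=
  block_mx (block_mx (lr_diff H i) 0 0 (lr_diff G i)) 0 (row_mx (phi i) (- x%:M)) (bd i).

Let diffE i (h : 'rV_(lr_rank H i.+1)) (g : 'rV_(lr_rank G i.+1)) (g' : 'rV_(lr_rank G i)) :
  (row_mx (row_mx h g) g' : 'rV_(rank i.+1)) *m diff i =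
  row_mx (row_mx (h *m lr_diff H i + g' *m phi i) (g *m lr_diff G i - x *: g')) (g' *m bd i).
Proof.
rewrite /diff mul_row_block mulmx0 add0r mul_row_block !mulmx0 addr0 add0r.
by rewrite mul_mx_row add_row_mx mulmxN mul_mx_scalar.
Qed.

Let augE (h : 'rV_(lr_rank H 0)) (g : 'rV_(lr_rank G 0)) (g' : 'rV_0) :
  (row_mx (row_mx h g) g' : 'rV_(rank 0)) *m aug =
  x *: (h *m lr_aug H) + g *m lr_aug G.
Proof. by rewrite /aug !mul_row_col mulmx0 addr0 -scalemxAr. Qed.

Let row_rankP i (v : 'rV[S]_(rank i)) :
  exists h g g', v = row_mx (row_mx h g) g'.
Proof. by exists (lsubmx (lsubmx v)), (rsubmx (lsubmx v)), (rsubmx v); rewrite !hsubmxK. Qed.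

Let eq_row3 i (h1 h2 : 'rV[S]_(lr_rank H i)) (g1 g2 : 'rV_(lr_rank G i)) (e1 e2 : 'rV_(shift i)) :
  h1 = h2 -> g1 = g2 -> e1 = e2 ->
  row_mx (row_mx h1 g1) e1 = row_mx (row_mx h2 g2) e2.
Proof. by move=> -> -> ->. Qed.

Lemma mapping_cone_augP f : C f <-> exists v : 'rV[S]_(rank 0), f = (v *m aug) 0 0.
Proof.
rewrite CP; split=> [[a [b [/(lr_augP G)[g ->] /(lr_augP H)[h ->] ->]]]|[v ->]].
  by exists (row_mx (row_mx h g) 0); rewrite augE !mxE addrC.
have [h [g [g' ->]]] := row_rankP v; rewrite augE.
exists ((g *m lr_aug G) 0 0), ((h *m lr_aug H) 0 0); split; try exact: lr_mem.
by rewrite [LHS]mxE [X in X + _]mxE addrC.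
Qed.

Lemma mapping_cone_exact0 (v : 'rV[S]_(rank 0)) :
  v *m aug = 0 <-> exists w : 'rV[S]_(rank 1), v = w *m diff 0%N.
Proof.
split=> [|[w ->]]; last first.
  have [h [g [g' ->]]] := row_rankP w; rewrite diffE augE.
  rewrite mulmxDl -mulmxA lr_diff_aug mulmx0 add0r -mulmxA -phi_aug.
  by rewrite mulmxBl -mulmxA lr_diff_aug mulmx0 sub0r -scalemxAl subrr.
have [h [g [g' ->]]] := row_rankP v; rewrite augE => e.
(* A relation [x b + a = 0] with [a] in [I] forces [b] into [I] by [regx]; a lift [g0] of [b] to [G]
   is the shifted component of the preimage, and correcting [h] and [g] by it leaves cycles. *)
have Ih : I ((h *m lr_aug H) 0 0).
  apply: regx; have := lr_mem G (- g); rewrite mulNmx.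
  by move/eqP: e; rewrite addr_eq0 => /eqP <-; rewrite mxE.
have [g0 e0] := proj1 (lr_augP G _) Ih.
have {Ih} e0 : h *m lr_aug H = g0 *m lr_aug G by apply/matrixP => i j; rewrite !ord1.
have [h1 e1] : exists h1, h - g0 *m phi 0%N = h1 *m lr_diff H 0%N.
  by apply/(lr_exact0 H); rewrite mulmxBl -mulmxA -phi_aug e0 subrr.
have [g1 e2] : exists g1, g + x *: g0 = g1 *m lr_diff G 0%N.
  by apply/(lr_exact0 G); rewrite mulmxDl -scalemxAl -e0 addrC.
exists (row_mx (row_mx h1 g1) g0); rewrite diffE -e1 -e2 subrK addrK.
by apply: eq_row3 => //; rewrite !thinmx0.
Qed.

Lemma mapping_cone_exact i (v : 'rV[S]_(rank i.+1)) :
  v *m diff i = 0 <-> exists w : 'rV[S]_(rank i.+2), v = w *m diff i.+1.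
Proof.
split=> [|[w ->]]; last first.
  have [h [g [g' ->]]] := row_rankP w; rewrite diffE diffE /=.
  rewrite mulmxDl -mulmxA lr_diff_diff mulmx0 add0r -[_ *m phi _ *m _]mulmxA -phi_diff.
  rewrite mulmxN mulNmx mulmxA addrN.
  rewrite mulmxBl -mulmxA lr_diff_diff mulmx0 sub0r scalerN opprK -scalemxAl addNr.
  rewrite (_ : - (g' *m lr_diff G i) *m bd i = 0) ?row_mx0 //.
  case: i {v w h g} g' => [|i] g' /=; first by rewrite mulmx0.
  by rewrite mulNmx mulmxN opprK -mulmxA lr_diff_diff mulmx0.
have [h [g [g' ->]]] := row_rankP v; rewrite diffE.
move=> /eqP; rewrite !row_mx_eq0 => /andP[/andP[/eqP eh /eqP eg] /eqP eg'].
(* For [i = 0] the block [bd] is zero and carries no information; that [g'] is a cycle comes from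
   applying [lr_aug H] to the first component. *)
have [g0 e0] : exists g0, - g' = g0 *m lr_diff G i.
  case: i {v} h g g' eh eg eg' => [|i] h g g' eh eg eg'.
    apply/(lr_exact0 G); move/(congr1 (mulmxr (lr_aug H))): eh => /=.
    rewrite mul0mx mulmxDl -mulmxA lr_diff_aug mulmx0 add0r -mulmxA -phi_aug => e.
    by rewrite mulNmx e oppr0.
  by apply/(lr_exact G); rewrite mulNmx -mulmxN.
have [h1 e1] : exists h1, h - g0 *m phi i.+1 = h1 *m lr_diff H i.+1.
  apply/(lr_exact H); rewrite mulmxBl -mulmxA -phi_diff mulmxA -e0 mulNmx opprK.
  exact: eh.
have [g1 e2] : exists g1, g + x *: g0 = g1 *m lr_diff G i.+1.
  by apply/(lr_exact G); rewrite mulmxDl -scalemxAl -e0 scalerN.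
exists (row_mx (row_mx h1 g1) g0); rewrite diffE -e1 -e2 subrK addrK.
by apply: eq_row3 => //=; rewrite mulmxN -e0 opprK.
Qed.

Lemma mapping_cone : linear_free_resolution C s.+1.
Proof.
apply: (@LinearFreeResolution C s.+1 rank aug diff).
- move=> a; rewrite /aug; case: (split_ordP a) => b ->; last by case: b.
  rewrite col_mxEu; case: (split_ordP b) => c ->; rewrite ?col_mxEu ?col_mxEd.
    by rewrite mxE; apply: (@dhomogM _ _ _ 1 _ s) => //; apply: lr_aug_homog.
  exact: lr_aug_homog.
- move=> i a b; rewrite /diff.
  case: (split_ordP a) => {}a ->; rewrite ?block_mxEul ?block_mxEdl; last first.
    case: (split_ordP b) => {}b ->; rewrite ?block_mxEdl ?block_mxEdr.
      case: (split_ordP b) => {}b ->; rewrite ?row_mxEl ?row_mxEr ?phi_homog //.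
      by rewrite !mxE; case: eqP => _; rewrite ?mulr1n ?mulr0n ?oppr0 ?rpred0 ?rpredN.
    case: i a b => [|i] a b /=; first by rewrite mxE rpred0.
    by rewrite mxE rpredN; apply: lr_diff_homog.
  case: (split_ordP b) => {}b ->; rewrite ?block_mxEul ?block_mxEur; last by rewrite mxE rpred0.
  case: (split_ordP a) => {}a ->; case: (split_ordP b) => {}b ->;
    rewrite ?block_mxEul ?block_mxEur ?block_mxEdl ?block_mxEdr; try exact: lr_diff_homog;
    by rewrite mxE rpred0.
- exact: mapping_cone_augP.
- exact: mapping_cone_exact0.
- exact: mapping_cone_exact.
Qed.

End MappingCone.
End LinearResolutions.

(** * Linear resolutions of squarefree Veronese ideals *)

Section VeroneseResolution.
Variables (F : fieldType) (n : nat).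
Local Notation S := {mpoly F[n]}.
Implicit Types (f : S) (A : {set 'I_n}).

(** Induction on [#|A|], from the unit ideal ([t = 0]) and the zero ideal ([A] empty, [t > 0]). The
    resolution is data but the comparison map is only known to exist, hence [inhabited]. *)
Lemma veronese_linear_free_resolution t A :
  inhabited (linear_free_resolution (veronese F t A set0) t).
Proof.
have [k] := ubnP #|A|; elim: k t A => // k IHk t A; rewrite ltnS => leAk.
have predE s B m : veronese_pred s B set0 m = (s <= #|mnm_supp m :&: B|)%N.
  by rewrite /veronese_pred -setI_eq0 setI0 eqxx orbF.
case: t => [|t].
  constructor; apply: (@free_linear_resolution _ _ _ _ 1 1%:M).
  - by move=> a; rewrite mxE ord1 eqxx dhomog1.
  - move=> f; split=> _; last by move=> m _.
    by exists f%:M; rewrite mulmx1 mxE eqxx mulr1n.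
  - by move=> v; rewrite mulmx1.
have [A0|[v vA]] := set_0Vmem A.
  constructor; apply: (@free_linear_resolution _ _ _ _ 0 0).
  - by case.
  - move=> f; split=> [Vf|[v ->]].
      exists 0; rewrite mul0mx mxE; apply/msuppnil0/eqP; rewrite -size_eq0 size_eq0.
      case E : (msupp f) => [//|m s]; have := Vf m.
      by rewrite E mem_head predE A0 setI0 cards0 => /(_ isT).
    by rewrite mulmx0 mxE; apply: ideal0; apply: veronese_ideal.
  - by move=> v _; apply: thinmx0.
have cA : (#|A| = #|A :\ v|.+1)%N by rewrite (cardsD1 v) vA.
have ltAk : (#|A :\ v| < k)%N by rewrite -cA.
have [G] := IHk t.+1 _ ltAk; have [H] := IHk t _ ltAk.
have IJ f : veronese F t.+1 (A :\ v) set0 f -> veronese F t (A :\ v) set0 f.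
  by move=> If m /If; rewrite !predE; apply: ltnW.
have [phi [homphi augphi diffphi]] := comparison_map G H IJ.
constructor; apply: (@mapping_cone _ _ _ _ _ _ 'X_v _ _ _ G H phi) => //.
- by rewrite dhomogX /= mdeg1.
(* ['X_v] is regular modulo the ideal on [A :\ v], whose generators do not involve [v]. *)
- move=> f /monomial_idealXM If m /If; rewrite !predE mnm_suppD mnm_suppU => le.
  apply: leq_trans le (subset_leq_card _); apply/subsetP => i.
  by rewrite !inE; case: (i == v); rewrite ?andbF.
have colonE g : veronese F t.+1 A set0 ('X_v * g) = veronese F t (A :\ v) set0 g.
  by rewrite -(veronese_colon F t vA) // -setI_eq0 setI0.
move=> f; split=> [Vf|[a [b [Va Vb ->]]]]; last first.
  apply: (idealD (veronese_ideal F t.+1 A set0)); last by rewrite colonE.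
  move=> m /Va; rewrite !predE => le; apply: leq_trans le (subset_leq_card _).
  by apply/setIS/subD1set.
(* The terms free of [v] lie in the ideal on [A :\ v]; the others are divisible by ['X_v], with
   quotient in the colon ideal. *)
have [[f1 f2] /= ef [f1p f2p]] := mpoly_split (fun m => m v == 0%N) f.
have [b eb] : exists b, f2 = 'X_v * b by apply: mpoly_divX => m /f2p[].
exists f1, b; split; last by rewrite ef eb.
  move=> m /f1p[mv /Vf]; rewrite !predE => le; apply: leq_trans le (subset_leq_card _).
  apply/subsetP => i; rewrite !inE; case: (i =P v) => [->|//].
  by rewrite mv.
by rewrite -colonE -eb => m /f2p[_ /Vf].
Qed.

Lemma linear_resolution_veronese t A : (0 < t)%N ->
  linear_resolution (veronese F t A set0).
Proof.
move=> t_gt0; have [R] := veronese_linear_free_resolution t A.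
exact: linear_resolution_of (veronese_ideal F t A set0) t_gt0 R.
Qed.

End VeroneseResolution.

(** * The total cut complex of a star *)

Section StarComplex.
Variable n : nat.
Local Notation W := [set~ ord_max : 'I_n.+1].
Implicit Types A M : {set 'I_n.+1}.

(** The centre is adjacent to every other vertex, so it belongs to no independent set with a second
    element. *)
Lemma star_independent M : (2 <= #|M|)%N ->
  independent (star n.+1) M = (M \subset W).
Proof.
move=> le2M; apply/idP/subsetP => [indM i iM|MW].
  rewrite !inE; apply/eqP => ei; rewrite ei in iM.
  have [j] : exists j, j \in M :\ ord_max.
    by apply/card_gt0P; move: le2M; rewrite (cardsD1 ord_max) iM.
  rewrite !inE => /andP[neq jM].
  move/forall_inP/(_ _ jM)/forall_inP/(_ _ iM): indM.
  by rewrite /star neq /= eqxx orbT.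
apply/forall_inP => i /MW iW; apply/forall_inP => j /MW jW.
rewrite !inE -!val_eqE /= in iW jW.
by rewrite /star negb_and negb_or iW jW orbT.
Qed.

(** A face must miss some [k] leaves, so the condition is [k <= #|W :\: A|], written without
    subtraction. *)
Lemma mem_star_total_cut k A : (2 <= k)%N ->
  (A \in total_cut_complex k (star n.+1)) = (k + #|A :&: W| <= n)%N.
Proof.
move=> le2k; have eqn : (#|W :\: A| + #|A :&: W| = n)%N.
  by rewrite addnC setIC cardsID cardsC1 card_ord.
rewrite -[X in (_ <= X)%N]eqn leq_add2r inE; apply/existsP/idP => [[M /and3P[indM /eqP cM AM]]|le].
  rewrite star_independent ?cM // in indM.
  by rewrite -cM subset_leq_card // subsetD indM disjoint_sym disjoints_subset.
have [M MWA cM] : exists2 M : {set 'I_n.+1}, M \subset W :\: A & #|M| = k.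
  have : (0 < #|[set M : {set 'I_n.+1} | M \subset W :\: A & #|M| == k]|)%N.
    by rewrite cards_draws bin_gt0.
  by case/card_gt0P => M; rewrite inE => /andP[MWA /eqP cM]; exists M.
move: MWA; rewrite subsetD => /andP[MW dMA].
exists M; rewrite star_independent ?cM // MW eqxx /=.
by rewrite -disjoints_subset disjoint_sym.
Qed.

End StarComplex.

Theorem theorem18 (F : fieldType) (k n : nat) (hk : (2 <= k)%N)
    (hn : (k + 1 <= n)%N) :
  let D := total_cut_complex k (star n) in
  (cohen_macaulay (stanley_reisner_ideal F D) /\
   cohen_macaulay (stanley_reisner_ideal F (alexander_dual D))) /\
  (linear_resolution (stanley_reisner_ideal F D) /\
   linear_resolution (stanley_reisner_ideal F (alexander_dual D))).
Proof.
(* From here on [n] counts the leaves, so the degree for the complex reads [(n - k).+1]. *)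
case: n hn => [|n]; rewrite addn1 // ltnS => hn D.
pose W := [set~ ord_max : 'I_n.+1].
have eD : stanley_reisner_ideal F D = veronese F (n - k).+1 W set0.
  apply: stanley_reisner_veronese => C.
  by rewrite /D mem_star_total_cut // -ltnNge ltn_subLR.
(* A nonface of the dual is the complement of a face, that is, a set containing at least [k]
   leaves. *)
have eDv : stanley_reisner_ideal F (alexander_dual D) = veronese F k W set0.
  apply: stanley_reisner_veronese => C.
  rewrite inE negbK /D mem_star_total_cut //.
  have eqn : (#|C :&: W| + #|~: C :&: W| = n)%N.
    by rewrite ![_ :&: W]setIC -setDE cardsID cardsC1 card_ord.
  by rewrite -[X in (_ <= X)%N]eqn leq_add2r.
rewrite eD eDv; split; split.
- by apply: cohen_macaulay_veronese; lia.
- by apply: cohen_macaulay_veronese; lia.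
- exact: linear_resolution_veronese.
- by apply: linear_resolution_veronese; lia.
Qed.
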